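(* For any $N\in\mathbb N$ and any $\epsilon>0$ there exists a domain $\Omega\subset\mathbb R^3$ with volume $|\Omega|=1$ such that its Maxwell's eigenvalues satisfy $\lambda_j(\Omega)\le\epsilon$ for all $j=1,\dots,N$. Moreover, the domain $\Omega$ can be chosen to be homeomorphic to a ball.
   Context: Domains are bounded, with Lipschitz boundary (so that the spectrum below is well defined). Maxwell's eigenvalues. For a bounded domain $\Omega\subset\mathbb R^3$ with Lipschitz boundary and outer normal $\nu$, consider $\mathrm{curl}\,\mathrm{curl}\,E=\lambda E$ in $\Omega$, $\nu\times E=0$ on $\partial\Omega$, restricted to divergence-free fields. Precisely, let $H_0(\mathrm{curl},\Omega)=\{u\in L^2(\Omega)^3:\mathrm{curl}\,u\in L^2(\Omega)^3,\ \nu\times u|_{\partial\Omega}=0\}$ (the boundary condition being understood in the weak sense) and $H(\mathrm{div}\,0,\Omega)=\{u\in L^2(\Omega)^3:\mathrm{div}\,u=0\}$. The Maxwell's eigenvalues are the eigenvalues of the nonnegative self-adjoint operator with compact resolvent in the Hilbert space $H(\mathrm{div}\,0,\Omega)$ (with the $L^2$ inner product) associated with the form $Q(E,H)=\int_\Omega\langle\mathrm{curl}\,E,\mathrm{curl}\,H\rangle$ with domain $H_0(\mathrm{curl},\Omega)\cap H(\mathrm{div}\,0,\Omega)$. They form a sequence $0\le\lambda_1(\Omega)\le\lambda_2(\Omega)\le\cdots\nearrow+\infty$, repeated according to multiplicity. *)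

(* Defs.v *)
From HB Require Import structures.
From mathcomp Require Import all_boot all_order all_algebra.
From mathcomp Require Import all_classical all_reals all_analysis.

Set Implicit Arguments.
Unset Strict Implicit.
Unset Printing Implicit Defensive.

Import Order.TTheory GRing.Theory Num.Theory.
Import numFieldNormedType.Exports.

Local Open Scope classical_set_scope.
Local Open Scope ring_scope.

(* R^3 is R * R * R. It carries the product topology (through the maximum norm);
   measurableR3 is the same type with the product of the Borel sigma-algebras on
   which lebesgue_measure is defined, since the sigma-algebra inferred for R
   itself has another display. *)
Notation R3 R := (R * R * R)%type.
Notation measurableR3 R :=
  (measurableTypeR R * measurableTypeR R * measurableTypeR R)%type.

(* The library's own instance for m1 \x m2 is shadowed by another one. *)
Lemma product_sigma_finite d1 d2 (T1 : measurableType d1)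
    (T2 : measurableType d2) (R : realType)
    (m1 : {sigma_finite_measure set T1 -> \bar R})
    (m2 : {sigma_finite_measure set T2 -> \bar R}) :
  sigma_finite setT (m1 \x m2)%E.
Proof.
have /sigma_finiteP[F [TF ndF Foo]] := sigma_finiteT m1.
have /sigma_finiteP[G [TG ndG Goo]] := sigma_finiteT m2.
exists (fun n => F n `*` G n).
  rewrite -setXTT TF TG predeqE => -[x y]; split.
    move=> [/= [n _ Fnx] [k _ Gky]]; exists (maxn n k) => //; split.
    - by move: x Fnx; exact/subsetPset/ndF/leq_maxl.
    - by move: y Gky; exact/subsetPset/ndG/leq_maxr.
  by move=> [n _ []/= ? ?]; split; exists n.
move=> k; have [? ?] := Foo k; have [? ?] := Goo k.
split; first exact: measurableX.
by rewrite product_measure1E// lte_mul_pinfty// ge0_fin_numE.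
Qed.

Section Euclidean_space.
Context {R : realType}.

Definition leb2 : set (measurableTypeR R * measurableTypeR R) -> \bar R :=
  (@lebesgue_measure R \x @lebesgue_measure R)%E.
HB.instance Definition _ := Measure.on leb2.
HB.instance Definition _ := Measure_isSigmaFinite.Build _ _ _ leb2
  (product_sigma_finite (@lebesgue_measure R) (@lebesgue_measure R)).

Definition leb3 : set (measurableR3 R) -> \bar R :=
  (leb2 \x @lebesgue_measure R)%E.
HB.instance Definition _ := Measure.on leb3.
HB.instance Definition _ := Measure_isSigmaFinite.Build _ _ _ leb3
  (product_sigma_finite leb2 (@lebesgue_measure R)).

Definition coord3 (x : R3 R) (i : 'I_3) : R :=
  [:: x.1.1; x.1.2; x.2]`_i.

Definition basis3 (i : 'I_3) : R3 R :=
  ((i == 0)%:R, (i == 1)%:R, (i == 2)%:R).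

Definition dot3 (x y : R3 R) : R := \sum_(i < 3) coord3 x i * coord3 y i.

Definition unit_ball3 : set (R3 R) := [set x | dot3 x x < 1].

End Euclidean_space.

Definition homeomorphic {S T : topologicalType} (A : set S) (B : set T) : Prop :=
  exists (f : S -> T) (g : T -> S),
    [/\ {within A, continuous f}, {within B, continuous g},
        set_fun A B f /\ set_fun B A g,
        (forall x, A x -> g (f x) = x) & (forall y, B y -> f (g y) = y)].

Section Lipschitz_domains.
Context {R : realType}.
Implicit Types Omega : set (R3 R).

(* Near each boundary point p, after a rigid change of coordinates centred at p,
   Omega is the region strictly below the graph of a Lipschitz function of the
   first two coordinates. *)
Definition lipschitz_boundary Omega : Prop :=
  forall p : R3 R, (closure Omega `\` interior Omega) p ->
  exists (e : 'I_3 -> R3 R) (g : R * R -> R) (r : R),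
    [/\ 0 < r,
        forall i j, dot3 (e i) (e j) = (i == j)%:R,
        lipschitz g &
        forall y, ball p r y ->
          (Omega y <->
           dot3 (y - p) (e 2) < g (dot3 (y - p) (e 0), dot3 (y - p) (e 1)))].

Definition lipschitz_domain Omega : Prop :=
  [/\ open Omega, connected Omega, Omega !=set0, bounded_set Omega
    & lipschitz_boundary Omega].

End Lipschitz_domains.

Section Maxwell.
Context {R : realType}.
Implicit Types (Omega : set (R3 R)) (f : R3 R -> R).

Definition vfield := 'I_3 -> R3 R -> R.
Implicit Types u v w E F H phi : vfield.

Definition pd (i : 'I_3) f : R3 R -> R := fun x => 'D_(basis3 i) f x.

Fixpoint Cn (n : nat) f : Prop :=
  continuous f /\
  if n is m.+1 then
    forall i, (forall x, derivable f x (basis3 i)) /\ Cn m (pd i f)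
  else True.

Definition smooth f : Prop := forall n, Cn n f.

Definition supported_in Omega f : Prop :=
  exists K, [/\ compact K, K `<=` Omega & forall x, ~ K x -> f x = 0].

Definition test_function Omega f : Prop := smooth f /\ supported_in Omega f.

(* The indices are cyclic: i + 1 and i + 2 are computed modulo 3. *)
Definition classical_curl phi : vfield :=
  fun i x => pd (i + 1) (phi (i + 2)) x - pd (i + 2) (phi (i + 1)) x.

Definition L2 Omega u : Prop :=
  forall i, measurable_fun (Omega : set (measurableR3 R)) (u i) /\
    leb3.-integrable Omega (fun x => (u i x ^+ 2)%:E).

Definition L2dot Omega u v : R :=
  \sum_(i < 3) \int[leb3]_(x in Omega) (u i x * v i x).

Definition ae_zero Omega u : Prop :=
  {ae leb3, forall x, Omega x -> forall i, u i x = 0}.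

Definition weak_curl Omega u w : Prop :=
  forall phi, (forall i, test_function Omega (phi i)) ->
    L2dot Omega u (classical_curl phi) = L2dot Omega w phi.

Definition weak_div0 Omega u : Prop :=
  forall f, test_function Omega f -> L2dot Omega u (fun i => pd i f) = 0.

Definition Hdiv0 Omega u : Prop := L2 Omega u /\ weak_div0 Omega u.

(* nu x u = 0 on the boundary in the weak sense, for a field u with weak curl w:
   Green's formula
     int_Omega <w, phi> - <u, curl phi> = int_(boundary) <nu x u, phi>
   has no boundary term for any phi smooth up to the boundary. *)
Definition tangential_trace0 Omega u w : Prop :=
  forall phi, (forall i, smooth (phi i)) ->
    L2dot Omega w phi = L2dot Omega u (classical_curl phi).

(* u is in H_0(curl, Omega) and w represents its weak curl, which is unique up
   to a null set. *)
Definition H0curl Omega u w : Prop :=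
  [/\ L2 Omega u, L2 Omega w, weak_curl Omega u w & tangential_trace0 Omega u w].

(* The graph of the operator associated with the form
     Q(E, H) = int_Omega <curl E, curl H>
   of domain H_0(curl, Omega) /\ H(div 0, Omega), in the Hilbert space
   H(div 0, Omega): E is mapped to F iff Q(E, H) = <F, H> for each H in the form
   domain. *)
Definition maxwell_operator Omega E F : Prop :=
  [/\ Hdiv0 Omega E, Hdiv0 Omega F &
      exists2 curlE, H0curl Omega E curlE &
      forall H curlH, H0curl Omega H curlH -> Hdiv0 Omega H ->
        L2dot Omega curlE curlH = L2dot Omega F H].

Definition maxwell_eigenfield Omega (lam : R) E : Prop :=
  ~ ae_zero Omega E /\ maxwell_operator Omega E (fun i x => lam * E i x).

Definition L2_independent Omega n (E : 'I_n -> vfield) : Prop :=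
  forall c : 'I_n -> R,
    ae_zero Omega (fun i x => \sum_(k < n) c k * E k i x) -> forall k, c k = 0.

(* At least n eigenvalues, counted with multiplicity, are at most t. *)
Definition eigenvalues_upto Omega (n : nat) (t : R) : Prop :=
  exists (lam : 'I_n -> R) (E : 'I_n -> vfield),
    [/\ forall k, lam k <= t,
        forall k, maxwell_eigenfield Omega (lam k) (E k)
      & L2_independent Omega E].

(* lambda_j(Omega) for j >= 1, the j-th eigenvalue in nondecreasing order with
   multiplicity; it is +oo if there are fewer than j eigenvalues. *)
Definition maxwell_eigenvalue Omega (j : nat) : \bar R :=
  ereal_inf [set t%:E | t in eigenvalues_upto Omega j].

End Maxwell.

(* Main.v *)
Require Import Defs.
From mathcomp Require Import all_boot all_order all_algebra.
From mathcomp Require Import all_classical all_reals all_analysis.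
From mathcomp Require Import measurable_realfun.
From mathcomp Require Import ring lra.

Set Implicit Arguments.
Unset Strict Implicit.
Unset Printing Implicit Defensive.

Import Order.TTheory GRing.Theory Num.Theory.
Import numFieldNormedType.Exports.
Local Open Scope classical_set_scope.
Local Open Scope ring_scope.

(** Take the flat box (0, L) x (0, L) x (0, L^-2), of volume 1, with L large.
    It is a Lipschitz domain homeomorphic to a ball, and its variables separate:
    for k >= 1 the field
        E_k = (0, 0, sin (k pi x / L) sin (pi y / L))
    is an eigenfield for the eigenvalue (pi / L)^2 (k^2 + 1).  Indeed E_k does
    not depend on z and points along z, so that it is divergence-free and normal
    to the two faces z = const; it vanishes on the four other faces.  Once N is
    fixed, the first N of these eigenvalues tend to 0 as L grows, while the
    height of the box shrinks to keep the volume equal to 1.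

    The j-th eigenvalue is defined by counting linearly independent eigenfields,
    so it suffices to exhibit these N fields.  Three facts carry the proof.

    - [integral_by_parts]: on a box, a partial derivative can be moved from one
      C^1 factor to the other when the product vanishes on the two faces
      orthogonal to the direction of differentiation (Fubini and the fundamental
      theorem of calculus).  It gives the weak divergence, the weak curl and the
      tangential trace of E_k.
    - [maxwell_operator_mode]: the weak boundary condition on a competitor H is
      an identity against all fields smooth up to the boundary.  The curl of E_k
      is such a field, so testing with it turns <curl E_k, curl H> into
      <curl curl E_k, H> with no further integration.
    - [eigenfields_independent]: the form is symmetric, hence eigenfields of
      distinct eigenvalues are orthogonal, hence independent.

    For the shape of the box, [lipschitz_boundary_obox] views an edge or a corner
    along a direction that leaves all the adjacent faces at once, so that the
    boundary is there the graph of a minimum of affine functions, and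
    [homeomorphic_obox_ball] goes through the whole space, onto which both the
    box and the ball are stretched. *)

(** * Coordinates *)

Lemma forall_ord3 (P : 'I_3 -> Prop) : P 0 -> P 1 -> P 2 -> forall i, P i.
Proof.
move=> P0 P1 P2 [[|[|[|//]]] hi].
- by rewrite (_ : Ordinal hi = 0)//; exact/val_inj.
- by rewrite (_ : Ordinal hi = 1)//; exact/val_inj.
- by rewrite (_ : Ordinal hi = 2)//; exact/val_inj.
Qed.

Section coordinates.
Context {R : realType}.

Lemma sum_ord3 (f : 'I_3 -> R) : \sum_(i < 3) f i = f 0 + f 1 + f 2.
Proof.
rewrite !big_ord_recl big_ord0 addr0 addrA.
by congr (f _ + f _ + f _); exact/val_inj.
Qed.

Lemma eq_R3 (x y : R3 R) :
  x.1.1 = y.1.1 -> x.1.2 = y.1.2 -> x.2 = y.2 -> x = y.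
Proof. by case: x y => [[x0 x1] x2] [[y0 y1] y2] /= -> -> ->. Qed.

Lemma dot3E (x y : R3 R) : dot3 x y = x.1.1 * y.1.1 + x.1.2 * y.1.2 + x.2 * y.2.
Proof. by rewrite /dot3 sum_ord3. Qed.

Lemma dot3_ge0 (x : R3 R) : 0 <= dot3 x x.
Proof. by rewrite dot3E !addr_ge0// -expr2 sqr_ge0. Qed.

Lemma dot3Z (c : R) (x : R3 R) : dot3 (c *: x) (c *: x) = c ^+ 2 * dot3 x x.
Proof. by rewrite !dot3E /= /GRing.scale/=; ring. Qed.

End coordinates.

(** * Continuity and open sets in products *)

Lemma continuousT_comp (S T U : topologicalType) (f : S -> T) (g : T -> U) :
  continuous f -> continuous g -> continuous (g \o f).
Proof. by move=> cf cg x; apply: continuous_comp; [exact: cf|exact: cg]. Qed.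

Lemma continuous_at_pair (S T U : topologicalType) (f : S -> T) (g : S -> U) x :
  {for x, continuous f} -> {for x, continuous g} ->
  {for x, continuous (fun x => (f x, g x))}.
Proof. by move=> cf cg; apply: cvg_pair. Qed.

Lemma continuous_pair (S T U : topologicalType) (f : S -> T) (g : S -> U) :
  continuous f -> continuous g -> continuous (fun x => (f x, g x)).
Proof. by move=> cf cg x; apply: continuous_at_pair; [exact: cf|exact: cg]. Qed.

Lemma open_setX (S T : topologicalType) (A : set S) (B : set T) :
  open A -> open B -> open (A `*` B).
Proof.
move=> oA oB; rewrite (_ : A `*` B = fst @^-1` A `&` snd @^-1` B)//.
apply: openI; apply: open_comp => // x _; [exact: cvg_fst|exact: cvg_snd].
Qed.

Section continuous_coordinates.
Context {R : realType}.

Lemma coord_continuous3 (i : 'I_3) : continuous (fun x : R3 R => coord3 x i).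
Proof.
case: i => [[|[|[|//]]]] ? x; rewrite /coord3/=.
- by apply: continuous_comp; [exact: cvg_fst|exact: cvg_fst].
- by apply: continuous_comp; [exact: cvg_fst|exact: cvg_snd].
- exact: cvg_snd.
Qed.

Lemma continuous_dot3 : continuous (fun x : R3 R => dot3 x x).
Proof.
have sq i : continuous (fun x : R3 R => coord3 x i * coord3 x i).
  by move=> x; apply: cvgM; exact: coord_continuous3.
have -> : (fun x : R3 R => dot3 x x) = (fun x => coord3 x 0 * coord3 x 0 +
    coord3 x 1 * coord3 x 1 + coord3 x 2 * coord3 x 2).
  by apply/funext => x; rewrite /dot3 sum_ord3.
move=> x; apply: cvgD; last exact: sq.
by apply: cvgD; exact: sq.
Qed.

End continuous_coordinates.

(** * Boxes and integrals over them *)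

Section boxes.
Context {R : realType}.

Definition obox (l u : R3 R) : set (R3 R) :=
  (`]l.1.1, u.1.1[ `*` `]l.1.2, u.1.2[) `*` `]l.2, u.2[.

Lemma open_obox (l u : R3 R) : open (obox l u).
Proof. by apply: open_setX; [apply: open_setX|]; exact: interval_open. Qed.

Lemma measurable_obox (l u : R3 R) : measurable (obox l u : set (measurableR3 R)).
Proof. by apply: measurableX; [apply: measurableX|]; exact: measurable_itv. Qed.

(** An open set is the union of the boxes with rational vertices that it
    contains, and there are countably many of them: this is how the topology of
    the product meets the product of the Borel sigma-algebras. *)
Lemma open_measurable3 (U : set (R3 R)) :
  open U -> measurable (U : set (measurableR3 R)).
Proof.
move=> oU.
pose cst (q : rat * rat * rat) : R3 R := (ratr q.1.1, ratr q.1.2, ratr q.2).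
pose F (q : (rat * rat * rat) * (rat * rat * rat)) : set (measurableR3 R) :=
  if `[< obox (cst q.1) (cst q.2) `<=` U >]
  then obox (cst q.1) (cst q.2) else set0.
have -> : (U : set (measurableR3 R)) = \bigcup_q F q.
  apply/seteqP; split=> [x Ux|x [q _]]; last first.
    by rewrite /F; case: ifPn => // /asboolP + xq; apply.
  have /nbhs_ballP [r /= r0 rU] : nbhs x U by exact: open_nbhs_nbhs.
  have lo (t : R) : exists q : rat, t - r < ratr q < t.
    have /rat_in_itvoo[q] : t - r < t by lra.
    by rewrite in_itv/=; exists q.
  have up (t : R) : exists q : rat, t < ratr q < t + r.
    have /rat_in_itvoo[q] : t < t + r by lra.
    by rewrite in_itv/=; exists q.
  case: x Ux rU => [[x y] z] Ux rU.
  have [[a1 ha1] [b1 hb1]] := (lo x, up x).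
  have [[a2 ha2] [b2 hb2]] := (lo y, up y).
  have [[a3 ha3] [b3 hb3]] := (lo z, up z).
  have Hq : obox (cst (a1, a2, a3)) (cst (b1, b2, b3)) `<=` U.
    move=> [[x' y'] z'] [[]] /=; rewrite !in_itv/= => h1 h2 h3.
    by apply: rU; (split; first split); rewrite /ball/= ltr_norml; lra.
  exists ((a1, a2, a3), (b1, b2, b3)) => //.
  rewrite /F asboolT//; (split; first split); rewrite /= in_itv/=; lra.
apply: countable_bigcupT_measurable => // q.
by rewrite /F; case: ifPn => _ //; exact: measurable_obox.
Qed.

Lemma continuous_measurable_fun3 (f : R3 R -> R) (D : set (R3 R)) :
  continuous f -> measurable (D : set (measurableR3 R)) ->
  measurable_fun (D : set (measurableR3 R)) f.
Proof.
move=> /continuousP cf mD.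
apply: (measurable_funS (E := setT)) => //.
apply: (measurability _ (RGenOpens.measurableE R)).
move=> _ [_ [a [b ->] <-]]; rewrite setTI; apply: open_measurable3.
exact/cf/interval_open.
Qed.

Lemma leb2X (A B : set R) : measurable A -> measurable B ->
  leb2 (A `*` B) = (lebesgue_measure A * lebesgue_measure B)%E.
Proof. by move=> mA mB; exact: product_measure1E. Qed.

Lemma leb3_oboxE (l u : R3 R) : leb3 (obox l u) =
  (lebesgue_measure (`]l.1.1, u.1.1[ : set R) *
   lebesgue_measure (`]l.1.2, u.1.2[ : set R) *
   lebesgue_measure (`]l.2, u.2[ : set R))%E.
Proof.
rewrite -leb2X; [|exact: measurable_itv|exact: measurable_itv].
by apply: product_measure1E; [apply: measurableX|]; exact: measurable_itv.
Qed.

Lemma leb3_obox (l u : R3 R) : l.1.1 < u.1.1 -> l.1.2 < u.1.2 -> l.2 < u.2 ->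
  leb3 (obox l u) = ((u.1.1 - l.1.1) * (u.1.2 - l.1.2) * (u.2 - l.2))%:E.
Proof.
move=> lu1 lu2 lu3; rewrite leb3_oboxE !lebesgue_measure_itv/= !lte_fin.
by rewrite lu1 lu2 lu3 -!EFinB -!EFinM.
Qed.

Lemma leb3_obox_lty (l u : R3 R) : (leb3 (obox l u) < +oo)%E.
Proof.
rewrite leb3_oboxE !lebesgue_measure_itv/=.
by do ![case: ifPn => _]; rewrite ?mul0e ?mule0 -?EFinB -?EFinM ?ltry.
Qed.

(** A continuous function is bounded on a box because it is so on the
    compact closed box. *)
Lemma bounded_obox (l u : R3 R) (f : R3 R -> R) :
  continuous f -> [bounded f x | x in obox l u].
Proof.
move=> cf; pose K := (`[l.1.1, u.1.1] `*` `[l.1.2, u.1.2]) `*` `[l.2, u.2].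
have cK : compact K.
  by apply: compact_setX; [apply: compact_setX|]; exact: segment_compact.
have : bounded_set (f @` K).
  by apply/compact_bounded/continuous_compact => //; exact: continuous_subspaceT.
move=> [M [Mr MfK]]; exists M; split=> // N MN x [[x1 x2] x3].
by apply: (MfK N MN); exists x => //; do ![split => //]; exact: subset_itv_oo_cc.
Qed.

Lemma continuous_integrable_obox (l u : R3 R) (f : R3 R -> R) :
  continuous f -> leb3.-integrable (obox l u) (EFin \o f).
Proof.
move=> cf; apply: measurable_bounded_integrable.
- exact: measurable_obox.
- exact: leb3_obox_lty.
- by apply: continuous_measurable_fun3 => //; exact: measurable_obox.
- exact: bounded_obox.
Qed.

(** Slicing a box along its third axis leaves integrals over rectangles; a
    function of two variables is reduced to the three-dimensional case by making
    it constant in the third one. *)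
Lemma continuous_integrable_rect (a b c d : R) (f : R * R -> R) :
  continuous f -> leb2.-integrable (`]a, b[ `*` `]c, d[) (EFin \o f).
Proof.
move=> cf; pose f3 (x : R3 R) := f x.1.
have cf3 : continuous f3.
  by move=> x; apply: continuous_comp; [exact: cvg_fst|exact: cf].
apply: measurable_bounded_integrable; first exact: measurableX.
- suff : (leb2 (`]a, b[ `*` `]c, d[) < +oo)%E by [].
  rewrite leb2X ?lebesgue_measure_itv//=.
  by do ![case: ifPn => _]; rewrite ?mul0e ?mule0 -?EFinB -?EFinM ?ltry.
- apply: (measurable_funS (E := setT)) => //.
  have mf3 : measurable_fun (setT : set (measurableR3 R)) f3.
    exact: continuous_measurable_fun3.
  have -> : f = f3 \o (fun p => (p, 0)) by [].
  by apply: measurableT_comp => //; exact: pair2_measurable.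
- have [M [Mr fM]] := @bounded_obox ((a, c), -1) ((b, d), 1) _ cf3.
  exists M; split=> // N MN p pD; apply: (fM N MN (p, 0)).
  by split => //=; rewrite in_itv/=; lra.
Qed.

End boxes.

(** * Integration by parts on a box *)

Section iterated_integrals.
Context {R : realType}.

(** Extended by 0, the integrand is integrable on the whole product, where
    Fubini's theorem applies. *)
Lemma integralX d1 d2 (T1 : measurableType d1) (T2 : measurableType d2)
    (m1 : {sigma_finite_measure set T1 -> \bar R})
    (m2 : {sigma_finite_measure set T2 -> \bar R})
    (A : set T1) (B : set T2) (f : T1 * T2 -> \bar R) :
  measurable A -> measurable B -> (m1 \x m2)%E.-integrable (A `*` B) f ->
  (\int[m1 \x m2]_(z in A `*` B) f z =
     \int[m1]_(x in A)
     \int[m2]_(y in B) f (x, y))%E /\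
  (\int[m1 \x m2]_(z in A `*` B) f z =
     \int[m2]_(y in B)
     \int[m1]_(x in A) f (x, y))%E.
Proof.
move=> mA mB intf.
have mAB : measurable (A `*` B) by exact: measurableX.
have intf' : (m1 \x m2)%E.-integrable setT (f \_ (A `*` B)).
  by apply/integrable_restrict => //; rewrite setTI.
have patchX x y : (f \_ (A `*` B)) (x, y) =
    ((fun x => (fun y => f (x, y)) \_ B) ^~ y \_ A) x.
  by rewrite !patchE in_setX/=; case: (x \in A); case: (y \in B).
split; rewrite [LHS]integral_mkcond.
  rewrite -integral12_prod_meas1// [RHS]integral_mkcond.
  apply: eq_integral => x _; rewrite /fubini_F [RHS]patchE.
  case: ifPn => xA; last first.
    by apply: integral0_eq => y _; rewrite patchX patchE (negPf xA).
  rewrite [RHS]integral_mkcond; apply: eq_integral => y _.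
  by rewrite patchX patchE xA.
rewrite -(integral21_prod_meas1 intf') [RHS]integral_mkcond.
apply: eq_integral => y _; rewrite /fubini_G [RHS]patchE.
case: ifPn => yB; last first.
  apply: integral0_eq => x _; rewrite patchX !patchE (negPf yB).
  by case: (x \in A).
rewrite [RHS]integral_mkcond; apply: eq_integral => x _.
by rewrite patchX !patchE yB.
Qed.

Lemma integral_derive_eq0 (a b : R) (F f : R -> R) : a < b -> continuous f ->
  (forall s : R, is_derive s 1 F (f s)) -> F a = 0 -> F b = 0 ->
  (\int[@lebesgue_measure R]_(s in `]a, b[) (f s)%:E = 0)%E.
Proof.
move=> ab cf dF Fa Fb.
have cF : continuous F.
  by move=> s; apply/differentiable_continuous/derivable1_diffP; have [] := dF s.
rewrite -(integral_itv_bndoo true false); last first.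
  apply/measurable_EFinP; apply: (measurable_funS (E := setT)) => //.
  exact: continuous_measurable_fun.
rewrite (continuous_FTC2 (F := F))// ?Fa ?Fb ?sube0//.
- exact: continuous_subspaceT.
- split; first by move=> s _; have [] := dF s.
  + exact/cvg_at_right_filter/cF.
  + exact/cvg_at_left_filter/cF.
- by move=> s _; rewrite derive1E; have [] := dF s.
Qed.

End iterated_integrals.

Section partial_derivatives.
Context {R : realType}.

(** A directional derivative is an ordinary derivative along any affine
    parametrization of the line: the two difference quotients are the same
    function. *)
Lemma is_derive_line (V W : normedModType R) (v : V) (gam : R -> V) (f : V -> W)
    (s : R) (df : W) : (forall h t, gam (h + t) = h *: v + gam t) ->
  is_derive (gam s) v f df <-> is_derive s 1 (f \o gam) df.
Proof.
move=> gamE.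
have E : (fun h : R => h^-1 *: ((f \o shift (gam s)) (h *: v) - f (gam s))) =
    (fun h : R =>
      h^-1 *: ((f \o gam \o shift s) (h *: (1 : R)) - (f \o gam) s)).
  by apply/funext => h; rewrite /= /shift/= -gamE /GRing.scale/= mulr1.
split=> -[fd fD].
  by split; rewrite /derivable /derive -E.
by split; rewrite /derivable /derive E.
Qed.

(** Integrating first in the direction of the derivative gives, on each line,
    the difference of the values of [f] on two opposite faces. *)
Lemma integral_pd_eq0 (l u : R3 R) (i : 'I_3) (f : R3 R -> R) :
  (forall j, coord3 l j < coord3 u j) ->
  continuous f -> (forall x, derivable f x (basis3 i)) -> continuous (pd i f) ->
  (forall x, coord3 x i = coord3 l i \/ coord3 x i = coord3 u i -> f x = 0) ->
  \int[leb3]_(x in obox l u) pd i f x = 0.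
Proof.
move=> lu cf df cdf f0.
have lu0 : l.1.1 < u.1.1 by exact: (lu 0).
have lu1 : l.1.2 < u.1.2 by exact: (lu 1).
have lu2 : l.2 < u.2 by exact: (lu 2).
have fD x : is_derive x (basis3 i) f (pd i f x) by split.
suff H : (\int[leb3]_(x in obox l u) (pd i f x)%:E = 0)%E by rewrite /Rintegral H.
pose D := `]l.1.1, u.1.1[ `*` `]l.1.2, u.1.2[.
have mD : measurable (D : set (measurableTypeR R * measurableTypeR R)).
  by apply: measurableX; exact: measurable_itv.
have int3 := @continuous_integrable_obox _ l u _ cdf.
have mI (a b : R) : measurable (`]a, b[ : set (measurableTypeR R)).
  exact: measurable_itv.
(* The third variable is innermost in F1 and outermost in F2; [slice] then
   orders the first two. *)
have [F1 F2] := @integralX _ _ _ _ _ leb2 (@lebesgue_measure R) D _ _ mD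
  (mI l.2 u.2) int3.
have cslice z : continuous (fun p : R * R => pd i f (p, z)).
  apply: (@continuousT_comp _ _ _ (fun p => (p, z)) (pd i f)) => //.
  by apply: continuous_pair; [move=> ?; exact: cvg_id|exact: cst_continuous].
have slice z := @integralX _ _ _ _ _ (@lebesgue_measure R)
  (@lebesgue_measure R) _ _ _ (mI l.1.1 u.1.1) (mI l.1.2 u.1.2)
  (@continuous_integrable_rect _ l.1.1 u.1.1 l.1.2 u.1.2 _ (cslice z)).
have line (gam : R -> R3 R) (a b : R) : a < b -> continuous gam ->
    (forall h t, gam (h + t) = h *: basis3 i + gam t) ->
    f (gam a) = 0 -> f (gam b) = 0 ->
    (\int[lebesgue_measure]_(s in `]a, b[) (pd i f (gam s))%:E = 0)%E.
  move=> ab cgam gamE fa fb.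
  apply: (@integral_derive_eq0 _ a b (f \o gam) (pd i f \o gam)) => //.
    exact: continuousT_comp.
  move=> s; exact: (@is_derive_line _ _ _ _ f s _ gamE).1 (fD (gam s)).
rewrite /obox -/D.
case: i cf df cdf f0 fD int3 F1 F2 cslice slice line => [[|[|[|//]]] hi];
  move=> cf df cdf f0 fD int3 F1 F2 cslice slice line.
- rewrite F2; apply: integral0_eq => z _; rewrite (slice z).2.
  apply: integral0_eq => y _; apply: (line (fun s => ((s, y), z))) => //.
  + by do 2?apply: continuous_pair;
      (exact: cst_continuous || move=> ?; exact: cvg_id).
  + move=> h t; apply: eq_R3; rewrite /= /GRing.scale/=; ring.
  + by apply: f0; left.
  + by apply: f0; right.
- rewrite F2; apply: integral0_eq => z _; rewrite (slice z).1.
  apply: integral0_eq => x _; apply: (line (fun s => ((x, s), z))) => //.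
  + by do 2?apply: continuous_pair;
      (exact: cst_continuous || move=> ?; exact: cvg_id).
  + move=> h t; apply: eq_R3; rewrite /= /GRing.scale/=; ring.
  + by apply: f0; left.
  + by apply: f0; right.
- rewrite F1; apply: integral0_eq => p _.
  apply: (line (fun s => (p, s))) => //.
  + by apply: continuous_pair; [exact: cst_continuous|move=> ?; exact: cvg_id].
  + move=> h t; apply: eq_R3; rewrite /= /GRing.scale/=; ring.
  + by apply: f0; left.
  + by apply: f0; right.
Qed.

Lemma integral_by_parts (s : R3 R) (i : 'I_3) (f g : R3 R -> R) :
  (forall j, 0 < coord3 s j) -> Cn 1 f -> Cn 1 g ->
  (forall x, coord3 x i = 0 \/ coord3 x i = coord3 s i -> f x * g x = 0) ->
  \int[leb3]_(x in obox 0 s) (pd i f x * g x) =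
  - \int[leb3]_(x in obox 0 s) (f x * pd i g x).
Proof.
have mO := @measurable_obox R 0 s.
move=> s_gt0 [cf /(_ i)[df [cdf _]]] [cg /(_ i)[dg [cdg _]]] fg0.
have pdE : pd i (f * g) = (fun x => pd i f x * g x + f x * pd i g x).
  apply/funext => x; rewrite /pd deriveM// /GRing.scale/=; ring.
have cM (a b : R3 R -> R) : continuous a -> continuous b ->
    continuous (fun x => a x * b x).
  by move=> ca cb x; apply: cvgM; [exact: ca|exact: cb].
apply/eqP; rewrite -addr_eq0 -RintegralD//.
- rewrite -pdE; apply/eqP; apply: integral_pd_eq0.
  + move=> j; rewrite (_ : coord3 0 j = 0)//.
    by case: j => [[|[|[|//]]]].
  + exact: cM.
  + by move=> x; exact: derivableM.
  + rewrite pdE => x; apply: cvgD; exact: cM.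
  + move=> x; rewrite (_ : coord3 0 i = 0); first exact: fg0.
    by case: (i) => [[|[|[|//]]]].
- by apply: continuous_integrable_obox; exact: cM.
- by apply: continuous_integrable_obox; exact: cM.
Qed.

End partial_derivatives.

(** * Orthogonality and independence of eigenfields *)

Section eigenfields.
Context {R : realType}.
Implicit Types (Omega : set (R3 R)) (E F u v : @vfield R).

(** The product is dominated by the sum of the squares. *)
Lemma L2_integrableM Omega u v i : measurable (Omega : set (measurableR3 R)) ->
  L2 Omega u -> L2 Omega v ->
  leb3.-integrable Omega (EFin \o (fun x => u i x * v i x)).
Proof.
move=> mO /(_ i)[mu iu] /(_ i)[mv iv].
apply: (le_integrable _ _ _ (integrableD _ iu iv)) => //.
- by apply/measurable_EFinP; exact: measurable_funM.
- move=> x _.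
  suff : `|u i x * v i x| <= `|u i x ^+ 2 + v i x ^+ 2| by rewrite lee_fin.
  rewrite [leRHS]ger0_norm ?addr_ge0 ?sqr_ge0// ler_norml.
  have := sqr_ge0 (u i x - v i x); have := sqr_ge0 (u i x + v i x).
  have := sqr_ge0 (u i x); have := sqr_ge0 (v i x).
  nra.
Qed.

Lemma L2dotC Omega u v : L2dot Omega u v = L2dot Omega v u.
Proof.
apply: eq_bigr => i _; apply: eq_Rintegral => x _; exact: mulrC.
Qed.

Lemma L2dotZl Omega u v c : measurable (Omega : set (measurableR3 R)) ->
  L2 Omega u -> L2 Omega v ->
  L2dot Omega (fun i x => c * u i x) v = c * L2dot Omega u v.
Proof.
move=> mO Lu Lv; rewrite /L2dot big_distrr/=; apply: eq_bigr => i _.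
rewrite -RintegralZl//; last exact: L2_integrableM.
by apply: eq_Rintegral => x _; rewrite mulrA.
Qed.

Lemma L2dotDl Omega u v w : measurable (Omega : set (measurableR3 R)) ->
  L2 Omega u -> L2 Omega v -> L2 Omega w ->
  L2dot Omega (fun i x => u i x + v i x) w = L2dot Omega u w + L2dot Omega v w.
Proof.
move=> mO Lu Lv Lw; rewrite /L2dot -big_split/=; apply: eq_bigr => i _.
rewrite -RintegralD//; try exact: L2_integrableM.
by apply: eq_Rintegral => x _; rewrite mulrDl.
Qed.

Lemma L2_cst0 Omega : measurable (Omega : set (measurableR3 R)) ->
  L2 Omega (fun=> cst 0).
Proof.
move=> mO i; split; first exact: measurable_cst.
have := integrable0 leb3 Omega; apply: eq_integrable => // x _.
by rewrite /= expr0n.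
Qed.

Lemma L2D Omega u v : measurable (Omega : set (measurableR3 R)) ->
  L2 Omega u -> L2 Omega v -> L2 Omega (fun i x => u i x + v i x).
Proof.
move=> mO Lu Lv i; have [mu iu] := Lu i; have [mv iv] := Lv i.
split; first exact: measurable_funD.
have := integrableD mO (integrableD mO iu iv)
   (integrableZl mO 2 (L2_integrableM i mO Lu Lv)).
apply: eq_integrable => // x _ /=.
transitivity (u i x ^+ 2 + v i x ^+ 2 + 2 * (u i x * v i x))%:E => //.
by congr EFin; ring.
Qed.

Lemma L2Z Omega u c : measurable (Omega : set (measurableR3 R)) ->
  L2 Omega u -> L2 Omega (fun i x => c * u i x).
Proof.
move=> mO Lu i; have [mu iu] := Lu i; split.
  by apply: measurable_funM => //; exact: measurable_cst.
have := integrableZl mO (c ^+ 2) iu; apply: eq_integrable => // x _ /=.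
by rewrite exprMn.
Qed.

Lemma L2dot_ae_zero Omega u v : measurable (Omega : set (measurableR3 R)) ->
  L2 Omega u -> L2 Omega v -> ae_zero Omega u -> L2dot Omega u v = 0.
Proof.
move=> mO Lu Lv u0; apply: big1 => i _; rewrite /Rintegral.
rewrite (ae_eq_integral (cst 0%E)) ?integral0//.
  by case/integrableP: (L2_integrableM i mO Lu Lv).
have aeF := ae_filter_ringOfSetsType (@leb3 R).
by apply: filterS u0 => x u0 /= Ox; rewrite u0// mul0r.
Qed.

Lemma L2dot_self_eq0 Omega u : measurable (Omega : set (measurableR3 R)) ->
  L2 Omega u -> L2dot Omega u u = 0 -> ae_zero Omega u.
Proof.
move=> mO Lu /eqP; rewrite psumr_eq0; last first.
  by move=> i _; apply: Rintegral_ge0 => x _; rewrite -expr2 sqr_ge0.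
move=> /allP uu0.
have uz i : ae_eq leb3 Omega (EFin \o (fun x => u i x * u i x)) (cst 0%E).
  have iuu := L2_integrableM i mO Lu Lu.
  apply/ae_eq_integral_abs => //; first by case/integrableP: iuu.
  have /= /eqP := uu0 i (mem_index_enum _).
  rewrite /Rintegral => fI0; have := integrable_fin_num mO iuu.
  move=> /fineK; rewrite fI0 => I0; rewrite [RHS]I0.
  apply: eq_integral => x _ /=.
  by rewrite ger0_norm// -expr2 sqr_ge0.
have aeF := ae_filter_ringOfSetsType (@leb3 R).
have := filter_forall aeF uz.
apply: filterS => x ux Ox i; have uu : (u i x * u i x)%:E = 0%:E by exact: ux.
by apply/eqP; rewrite -[_ == _]orbb -mulf_eq0; apply/eqP; case: uu.
Qed.

Definition lincomb n (c : 'I_n -> R) (E : 'I_n -> vfield) (s : seq 'I_n) : vfield :=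
  fun i x => \sum_(k <- s) c k * E k i x.

Lemma lincomb_nil n c (E : 'I_n -> vfield) : lincomb c E [::] = (fun=> cst 0).
Proof. by apply/funext => i; apply/funext => x; rewrite /lincomb big_nil. Qed.

Lemma lincomb_cons n c (E : 'I_n -> vfield) k s :
  lincomb c E (k :: s) = (fun i x => c k * E k i x + lincomb c E s i x).
Proof. by apply/funext => i; apply/funext => x; rewrite /lincomb big_cons. Qed.

Lemma L2_lincomb Omega n (c : 'I_n -> R) (E : 'I_n -> vfield) (s : seq 'I_n) :
  measurable (Omega : set (measurableR3 R)) -> (forall k, L2 Omega (E k)) ->
  L2 Omega (lincomb c E s).
Proof.
move=> mO LE; elim: s => [|k s IHs]; first by rewrite lincomb_nil; exact: L2_cst0.
by rewrite lincomb_cons; apply: L2D => //; exact: L2Z.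
Qed.

Lemma L2dot_lincomb Omega n (c : 'I_n -> R) (E : 'I_n -> vfield) v (s : seq 'I_n) :
  measurable (Omega : set (measurableR3 R)) ->
  (forall k, L2 Omega (E k)) -> L2 Omega v ->
  L2dot Omega (lincomb c E s) v = \sum_(k <- s) c k * L2dot Omega (E k) v.
Proof.
move=> mO LE Lv; elim: s => [|k s IHs].
  rewrite big_nil lincomb_nil; apply: big1 => i _.
  under eq_Rintegral do rewrite mul0r.
  by rewrite /Rintegral integral0.
rewrite big_cons -IHs -L2dotZl// -L2dotDl// ?lincomb_cons//; first exact: L2Z.
exact: L2_lincomb.
Qed.

(** Testing each of the two eigenvalue equations with the other field
    computes <curl E, curl F> in two ways: lam <E, F> = mu <E, F>. *)
Lemma eigenfield_orthogonal Omega (lam mu : R) E F :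
  measurable (Omega : set (measurableR3 R)) -> lam != mu ->
  maxwell_eigenfield Omega lam E -> maxwell_eigenfield Omega mu F ->
  L2dot Omega E F = 0.
Proof.
move=> mO lammu [_ [HE _ [cE H0E opE]]] [_ [HF _ [cF H0F opF]]].
have EF := opE _ _ H0F HF; have FE := opF _ _ H0E HE.
have [[LE _] [LF _]] := (HE, HF).
move: EF FE; rewrite L2dotC => ->; rewrite !L2dotZl// [in RHS]L2dotC.
move/eqP; rewrite -subr_eq0 -mulrBl mulf_eq0 subr_eq0 (negPf lammu)/=.
by move/eqP.
Qed.

Lemma eigenfields_independent Omega n (lam : 'I_n -> R) (E : 'I_n -> vfield) :
  measurable (Omega : set (measurableR3 R)) -> injective lam ->
  (forall k, maxwell_eigenfield Omega (lam k) (E k)) -> L2_independent Omega E.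
Proof.
move=> mO injlam eigE c c0 k.
have LE j : L2 Omega (E j) by have [_ [[]]] := eigE j.
have := L2dot_ae_zero mO (L2_lincomb c (index_enum _) mO LE) (LE k) c0.
rewrite L2dot_lincomb// (bigD1 k)//= big1 ?addr0 => [/eqP|j jk]; last first.
  rewrite (eigenfield_orthogonal mO _ (eigE j) (eigE k)) ?mulr0//.
  by rewrite (inj_eq injlam).
rewrite mulf_eq0 => /orP[/eqP//|/eqP].
by move=> /(L2dot_self_eq0 mO (LE k)) Ek0; have [] := eigE k.
Qed.

End eigenfields.

(** * Explicit fields with separated variables *)

Section modes.
Context {R : realType}.

(** Sine and cosine are indexed by a boolean so that the derivatives of a
    product of them are again such products, see [pd_plane_wave]. *)
Definition wave (b : bool) : R -> R := if b then cos else sin.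

Lemma is_derive_wave (b : bool) (t : R) :
  is_derive t 1 (wave b) ((-1) ^+ b * wave (~~ b) t).
Proof.
case: b; rewrite /wave/= ?expr1 ?expr0 ?mul1r ?mulN1r.
  exact: is_derive_cos.
exact: is_derive_sin.
Qed.

Lemma continuous_wave (b : bool) : continuous (wave b).
Proof. by case: b; [exact: continuous_cos|exact: continuous_sin]. Qed.

Lemma is_derive_wave_scaled (b : bool) (r t : R) :
  is_derive t 1 (fun s : R => wave b (r * s))
    (r * ((-1) ^+ b * wave (~~ b) (r * t))).
Proof.
rewrite mulrC; apply: (@is_derive1_comp _ (wave b) (fun s => r * s)).
  exact: is_derive_wave.
have := @is_deriveZ _ _ _ (@id R) r t 1 1 (is_derive_id _ _).
by rewrite /GRing.scale/= mulr1.
Qed.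

Definition plane_wave (p q c : R) (m n : bool) (x : R3 R) : R :=
  c * (wave m (p * x.1.1) * wave n (q * x.1.2)).

Lemma continuous_plane_wave p q c m n : continuous (plane_wave p q c m n).
Proof.
have cw b r i : continuous (fun x : R3 R => wave b (r * coord3 x i)).
  apply: (@continuousT_comp _ _ _ (fun x => r * coord3 x i)).
    by move=> x; apply: cvgM; [exact: cvg_cst|exact: coord_continuous3].
  exact: continuous_wave.
move=> x; apply: cvgM; first exact: cvg_cst.
by apply: cvgM; [exact: (cw m p 0)|exact: (cw n q 1)].
Qed.

Lemma is_derive_plane_wave0 p q c m n x :
  is_derive x (basis3 0) (plane_wave p q c m n)
    (plane_wave p q (c * p * (-1) ^+ m) (~~ m) n x).
Proof.
case: x => [[x y] z].
have gamE (h t : R) : ((h + t, y), z) = h *: basis3 0 + ((t, y), z) :> R3 R.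
  by apply: eq_R3; rewrite /= /GRing.scale/=; ring.
apply: (@is_derive_line _ _ _ _ _ (plane_wave p q c m n) _ _ gamE).2.
have -> : plane_wave p q c m n \o (fun s => ((s, y), z)) =
    (c * wave n (q * y)) \*: (fun s : R => wave m (p * s)).
  by apply/funext => s; rewrite /plane_wave/= /GRing.scale/=; ring.
apply: is_derive_eq; first exact/is_deriveZ/is_derive_wave_scaled.
by rewrite /plane_wave/= /GRing.scale/=; ring.
Qed.

Lemma is_derive_plane_wave1 p q c m n x :
  is_derive x (basis3 1) (plane_wave p q c m n)
    (plane_wave p q (c * q * (-1) ^+ n) m (~~ n) x).
Proof.
case: x => [[x y] z].
have gamE (h t : R) : ((x, h + t), z) = h *: basis3 1 + ((x, t), z) :> R3 R.
  by apply: eq_R3; rewrite /= /GRing.scale/=; ring.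
apply: (@is_derive_line _ _ _ _ _ (plane_wave p q c m n) _ _ gamE).2.
have -> : plane_wave p q c m n \o (fun s => ((x, s), z)) =
    (c * wave m (p * x)) \*: (fun s : R => wave n (q * s)).
  by apply/funext => s; rewrite /plane_wave/= /GRing.scale/=; ring.
apply: is_derive_eq; first exact/is_deriveZ/is_derive_wave_scaled.
by rewrite /plane_wave/= /GRing.scale/=; ring.
Qed.

Lemma is_derive_plane_wave2 p q c m n x :
  is_derive x (basis3 2) (plane_wave p q c m n) (plane_wave p q 0 m n x).
Proof.
case: x => [[x y] z].
have gamE (h t : R) : ((x, y), h + t) = h *: basis3 2 + ((x, y), t) :> R3 R.
  by apply: eq_R3; rewrite /= /GRing.scale/=; ring.
apply: (@is_derive_line _ _ _ _ _ (plane_wave p q c m n) _ _ gamE).2.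
rewrite {2}/plane_wave mul0r.
exact: (is_derive_cst (c * (wave m (p * x) * wave n (q * y)))).
Qed.

Lemma pd_plane_wave p q c m n :
  [/\ pd 0 (plane_wave p q c m n) = plane_wave p q (c * p * (-1) ^+ m) (~~ m) n,
      pd 1 (plane_wave p q c m n) = plane_wave p q (c * q * (-1) ^+ n) m (~~ n)
    & pd 2 (plane_wave p q c m n) = plane_wave p q 0 m n].
Proof.
split; apply/funext => x.
- by have [] := is_derive_plane_wave0 p q c m n x.
- by have [] := is_derive_plane_wave1 p q c m n x.
- by have [] := is_derive_plane_wave2 p q c m n x.
Qed.

Lemma plane_wave_c0 p q m n : plane_wave p q 0 m n = cst 0.
Proof. by apply/funext => x; rewrite /plane_wave mul0r. Qed.

(** The family of plane waves is stable under partial derivatives, so its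
    members are smooth by induction on the order. *)
Lemma smooth_plane_wave p q c m n : smooth (plane_wave p q c m n).
Proof.
move=> k; elim: k c m n => [|k IHk] c m n.
  by split=> //; exact: continuous_plane_wave.
have [E0 E1 E2] := pd_plane_wave p q c m n.
split; first exact: continuous_plane_wave.
apply: forall_ord3; rewrite ?E0 ?E1 ?E2; split=> [x|]; try exact: IHk.
- by have [] := is_derive_plane_wave0 p q c m n x.
- by have [] := is_derive_plane_wave1 p q c m n x.
- by have [] := is_derive_plane_wave2 p q c m n x.
Qed.

Lemma smooth_continuous (f : R3 R -> R) : smooth f -> continuous f.
Proof. by move=> /(_ 0%N)[]. Qed.

Lemma smooth_pd (i : 'I_3) (f : R3 R -> R) : smooth f -> smooth (pd i f).
Proof. by move=> sf n; have [_ /(_ i)[]] := sf n.+1. Qed.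

(** The field (0, 0, sin (p x) sin (q y)). *)
Definition mode p q : vfield := fun i =>
  plane_wave p q (i == 2)%:R false false.

(** The curl of [mode p q], namely
    (q sin (p x) cos (q y), - p cos (p x) sin (q y), 0). *)
Definition mode_curl p q : vfield := fun i =>
  plane_wave p q [:: q; - p; 0]`_i (i == 1) (i == 0).

Lemma smooth_mode p q (i : 'I_3) : smooth (mode p q i).
Proof. exact: smooth_plane_wave. Qed.

Lemma smooth_mode_curl p q (i : 'I_3) : smooth (mode_curl p q i).
Proof. exact: smooth_plane_wave. Qed.

Lemma classical_curlE (phi : @vfield R) x :
  [/\ classical_curl phi 0 x = pd 1 (phi 2) x - pd 2 (phi 1) x,
      classical_curl phi 1 x = pd 2 (phi 0) x - pd 0 (phi 2) x
    & classical_curl phi 2 x = pd 0 (phi 1) x - pd 1 (phi 0) x].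
Proof.
by split; rewrite /classical_curl; congr (pd _ (phi _) x - pd _ (phi _) x);
  exact/val_inj.
Qed.

Lemma curl_mode_curl p q : classical_curl (mode_curl p q) =
  (fun i x => (p ^+ 2 + q ^+ 2) * mode p q i x).
Proof.
apply/funext => i; apply/funext => x; move: i.
have [c0 c1 c2] := classical_curlE (mode_curl p q) x.
have E (i : 'I_3) := pd_plane_wave p q [:: q; - p; 0]`_i
  (i == 1 :> 'I_3) (i == 0 :> 'I_3).
apply: forall_ord3; rewrite ?c0 ?c1 ?c2 /mode_curl.
- have [_ -> _] := E 2; have [_ _ ->] := E 1.
  by rewrite /mode /plane_wave/=; ring.
- have [_ _ ->] := E 0; have [-> _ _] := E 2.
  by rewrite /mode /plane_wave/=; ring.
- have [-> _ _] := E 1; have [_ -> _] := E 0.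
  by rewrite /mode /plane_wave/=; ring.
Qed.

End modes.

(** * Modes of a box *)

Section box_modes.
Context {R : realType} (s : R3 R) (p q : R).
Context (s_gt0 : forall i, 0 < coord3 s i).
Context (p_sin : sin (p * s.1.1) = 0) (q_sin : sin (q * s.1.2) = 0).

Let Omega : set (R3 R) := obox 0 s.

Let mO : measurable (Omega : set (measurableR3 R)).
Proof. exact: measurable_obox. Qed.

Lemma continuous_L2 (u : @vfield R) : (forall i, continuous (u i)) -> L2 Omega u.
Proof.
move=> cu i; split; first exact: continuous_measurable_fun3.
have cu2 : continuous (fun x => u i x * u i x).
  by move=> x; apply: cvgM; exact: cu.
have := @continuous_integrable_obox R 0 s _ cu2.
by apply: eq_integrable => // x _; rewrite /= expr2.
Qed.

Lemma mode_eq0 (i : 'I_3) (x : R3 R) : i != 2 ->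
  coord3 x i = 0 \/ coord3 x i = coord3 s i -> mode p q 2 x = 0.
Proof.
rewrite /mode /plane_wave /wave/= /coord3; move: i; apply: forall_ord3 => //= _.
- by case=> ->; rewrite ?mulr0 ?sin0 ?p_sin mul0r mulr0.
- by case=> ->; rewrite ?mulr0 ?sin0 ?q_sin ?mulr0.
Qed.

Lemma L2_mode : L2 Omega (mode p q).
Proof. by apply: continuous_L2 => i; exact/smooth_continuous/smooth_mode. Qed.

Lemma L2_mode_curl : L2 Omega (mode_curl p q).
Proof. by apply: continuous_L2 => i; exact/smooth_continuous/smooth_mode_curl. Qed.

Lemma L2dot_mode (v : @vfield R) :
  L2dot Omega (mode p q) v = \int[leb3]_(x in Omega) (mode p q 2 x * v 2 x).
Proof.
rewrite /L2dot sum_ord3 {1 2}/mode/= !plane_wave_c0.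
under eq_Rintegral do rewrite mul0r.
under [X in _ + X + _]eq_Rintegral do rewrite mul0r.
by rewrite /Rintegral integral0 !add0r.
Qed.

(** The third component of the mode is constant in z, and the test function
    vanishes on the faces because its support lies inside the open box. *)
Lemma weak_div0_mode : weak_div0 Omega (mode p q).
Proof.
move=> f [sf [K [_ KO f0]]]; rewrite L2dot_mode.
apply/eqP; rewrite -oppr_eq0 -integral_by_parts//.
- have [_ _ ->] := pd_plane_wave p q 1 false false.
  rewrite plane_wave_c0; under eq_Rintegral do rewrite mul0r.
  by rewrite /Rintegral integral0.
- exact: smooth_mode.
- move=> x xs; rewrite f0 ?mulr0// => /KO[_]; move: xs.
  rewrite /coord3/= in_itv/=.
  by case=> ->; rewrite ltxx ?andbF.
Qed.

(** The two derivatives in the curl of the mode act along x and y, and the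
    mode vanishes on the faces orthogonal to these directions; hence no boundary
    term, whatever the values of [phi] there. *)
Lemma green_mode (phi : @vfield R) : (forall i, smooth (phi i)) ->
  L2dot Omega (mode_curl p q) phi = L2dot Omega (mode p q) (classical_curl phi).
Proof.
move=> sphi; rewrite L2dot_mode /L2dot sum_ord3.
have [d0 d1 _] := pd_plane_wave p q 1 false false.
have cM (f g : R3 R -> R) : smooth f -> smooth g ->
    leb3.-integrable Omega (EFin \o (fun x => f x * g x)).
  move=> /smooth_continuous cf /smooth_continuous cg.
  apply: continuous_integrable_obox => x.
  by apply: cvgM; [exact: cf|exact: cg].
have I0 : \int[leb3]_(x in Omega) (mode_curl p q 0 x * phi 0 x) =
    - \int[leb3]_(x in Omega) (mode p q 2 x * pd 1 (phi 0) x).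
  rewrite -integral_by_parts//; [|exact: smooth_mode|exact: sphi|].
    by apply: eq_Rintegral => x _; rewrite d1 /mode_curl /plane_wave/=; ring.
  by move=> x xs; rewrite (mode_eq0 _ xs)// mul0r.
have I1 : \int[leb3]_(x in Omega) (mode_curl p q 1 x * phi 1 x) =
    \int[leb3]_(x in Omega) (mode p q 2 x * pd 0 (phi 1) x).
  rewrite -[RHS]opprK -integral_by_parts//; [|exact: smooth_mode|exact: sphi|].
    rewrite -mulN1r -RintegralZl//; last first.
      by apply: cM; [exact/smooth_pd/smooth_mode|].
    by apply: eq_Rintegral => x _; rewrite d0 /mode_curl /plane_wave/=; ring.
  by move=> x xs; rewrite (mode_eq0 _ xs)// mul0r.
have I2 : \int[leb3]_(x in Omega) (mode_curl p q 2 x * phi 2 x) = 0.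
  rewrite /mode_curl/= plane_wave_c0; under eq_Rintegral do rewrite mul0r.
  by rewrite /Rintegral integral0.
rewrite I0 I1 I2 addr0 addrC -RintegralB//.
- apply: eq_Rintegral => x _; have [_ _ ->] := classical_curlE phi x.
  by rewrite mulrBr.
- by apply: cM; [exact: smooth_mode|exact: smooth_pd].
- by apply: cM; [exact: smooth_mode|exact: smooth_pd].
Qed.

Lemma H0curl_mode : H0curl Omega (mode p q) (mode_curl p q).
Proof.
split; [exact: L2_mode|exact: L2_mode_curl| |exact: green_mode].
by move=> phi tphi; rewrite green_mode// => i; have [] := tphi i.
Qed.

(** The curl of the mode is smooth on the whole space, so it is an
    admissible [phi] in the tangential trace condition satisfied by the
    competitor [H]. *)
Lemma maxwell_operator_mode :
  maxwell_operator Omega (mode p q) (fun i x => (p ^+ 2 + q ^+ 2) * mode p q i x).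
Proof.
split.
- by split; [exact: L2_mode|exact: weak_div0_mode].
- split; first exact: (L2Z _ mO L2_mode).
  move=> f tf; rewrite (L2dotZl _ mO L2_mode) ?weak_div0_mode ?mulr0//.
  by apply: continuous_L2 => i; apply/smooth_continuous/smooth_pd; case: tf.
- exists (mode_curl p q); first exact: H0curl_mode.
  move=> H curlH [_ _ _ trH] _; rewrite L2dotC trH; last exact: smooth_mode_curl.
  by rewrite curl_mode_curl L2dotC.
Qed.

(** The third component of the mode is positive on the box between the
    origin and its first nodal planes x = pi / p and y = pi / q. *)
Lemma mode_neq0 : 0 < p -> 0 < q -> ~ ae_zero Omega (mode p q).
Proof.
move=> p_gt0 q_gt0 mode0.
pose w : R3 R := ((Num.min s.1.1 (pi / p), Num.min s.1.2 (pi / q)), s.2).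
have w0 : 0 < w.1.1 by rewrite lt_min (s_gt0 0) divr_gt0// pi_gt0.
have w1 : 0 < w.1.2 by rewrite lt_min (s_gt0 1) divr_gt0// pi_gt0.
have w2 : 0 < w.2 by exact: (s_gt0 2).
have : leb3 (obox 0 w) = 0%E.
  apply: measure_negligible; first exact: measurable_obox.
  apply: negligibleS mode0 => -[[x y] z] [[]] /=; rewrite !in_itv/= !lt_min.
  move=> /andP[x0 /andP[xs xp]] /andP[y0 /andP[ys yq]] /andP[z0 zs] xyz0.
  have : mode p q 2 ((x, y), z) = 0.
    by apply: xyz0; (split; first split); rewrite /= in_itv/= ?x0 ?y0 ?z0.
  rewrite /mode /plane_wave /wave/= mul1r => /eqP; apply/negP.
  by rewrite mulf_neq0// gt_eqF// sin_gt0_pi// mulr_gt0//= mulrC -ltr_pdivlMr.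
by rewrite leb3_obox// => -[] /eqP; rewrite !subr0 !mulf_eq0 !gt_eqF.
Qed.

Lemma maxwell_eigenfield_mode : 0 < p -> 0 < q ->
  maxwell_eigenfield Omega (p ^+ 2 + q ^+ 2) (mode p q).
Proof.
by move=> p_gt0 q_gt0; split; [exact: mode_neq0|exact: maxwell_operator_mode].
Qed.

End box_modes.

(** * Boxes are Lipschitz domains *)

Section lipschitz_box.
Context {R : realType}.

Lemma bounded_set_obox (l u : R3 R) : bounded_set (obox l u).
Proof.
have : compact ((`[l.1.1, u.1.1] `*` `[l.1.2, u.1.2]) `*` `[l.2, u.2]).
  by apply: compact_setX; [apply: compact_setX|]; exact: segment_compact.
move=> /compact_bounded[M [Mr bM]]; exists M; split=> // N MN x [[x1 x2] x3].
by apply: (bM N MN); do ![split => //]; exact: subset_itv_oo_cc.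
Qed.

(** A star-shaped set is a union of segments with a common end. *)
Lemma star_connected (V : normedModType R) (A : set V) (c : V) :
  A c -> (forall x t, A x -> 0 <= t <= 1 -> A (c + t *: (x - c))) -> connected A.
Proof.
move=> Ac starA.
have -> : A = \bigcup_(x in A) ((fun t : R => c + t *: (x - c)) @` `[0, 1]).
  apply/seteqP; split=> [x Ax|_ [x Ax [t t01 <-]]].
    exists x => //; exists 1; first by rewrite /= in_itv/= ler01 lexx.
    by rewrite scale1r addrC subrK.
  by apply: starA => //; move: t01; rewrite /= in_itv.
apply: bigcup_connected.
  exists c => x Ax; exists 0; last by rewrite scale0r addr0.
  by rewrite /= in_itv/= ler01 lexx.
move=> x Ax; apply: connected_continuous_connected; first exact: segment_connected.
apply: continuous_subspaceT => t.
apply: cvgD; first exact: cvg_cst.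
by apply: cvgZr_tmp; exact: cvg_id.
Qed.

Lemma itv_convex (a b c x t : R) : a < c < b -> a < x < b -> 0 <= t <= 1 ->
  a < c + t * (x - c) < b.
Proof.
move=> /andP[ac cb] /andP[ax xb] /andP[t0 t1].
have : 0 <= t * (x - a) by rewrite mulr_ge0//; lra.
have : 0 <= t * (b - x) by rewrite mulr_ge0//; lra.
have [->|t_neq1] := eqVneq t 1; first lra.
have t_lt1 : 0 < 1 - t by rewrite subr_gt0 lt_neqAle t_neq1.
have : 0 < (1 - t) * (c - a) by rewrite mulr_gt0//; lra.
have : 0 < (1 - t) * (b - c) by rewrite mulr_gt0//; lra.
lra.
Qed.

Lemma connected_obox (l u : R3 R) : obox l u !=set0 -> connected (obox l u).
Proof.
move=> [c Ac]; apply: (star_connected Ac) => x t.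
case: c x Ac => [[c0 c1] c2] [[x0 x1] x2] [[]] /=; rewrite !in_itv/=.
move=> hc0 hc1 hc2 [[]] /=; rewrite !in_itv/= => hx0 hx1 hx2 ht.
by (split; first split); rewrite /= in_itv/=; exact: itv_convex.
Qed.

Lemma lipschitz_min_affine2 (a b c : R * R * R) :
  lipschitz (fun x : R * R => Num.min (Num.min
    (a.1.1 * x.1 + a.1.2 * x.2 + a.2) (b.1.1 * x.1 + b.1.2 * x.2 + b.2))
    (c.1.1 * x.1 + c.1.2 * x.2 + c.2)).
Proof.
pose k := `|a.1.1| + `|a.1.2| + (`|b.1.1| + `|b.1.2|) + (`|c.1.1| + `|c.1.2|).
have aff (r : R * R * R) (x y : R * R) : `|r.1.1| + `|r.1.2| <= k ->
    `|(r.1.1 * x.1 + r.1.2 * x.2 + r.2) - (r.1.1 * y.1 + r.1.2 * y.2 + r.2)|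
    <= k * `|x - y|.
  move=> rk.
  have -> : (r.1.1 * x.1 + r.1.2 * x.2 + r.2) - (r.1.1 * y.1 + r.1.2 * y.2 + r.2)
    = r.1.1 * (x.1 - y.1) + r.1.2 * (x.2 - y.2) by ring.
  apply: (le_trans (ler_normD _ _)); rewrite !normrM.
  apply: (@le_trans _ _ ((`|r.1.1| + `|r.1.2|) * `|x - y|)); last exact: ler_wpM2r.
  by rewrite mulrDl lerD// ler_wpM2l// [leRHS]prod_normE le_max lexx ?orbT.
have minL (D x y x' y' : R) : `|x - x'| <= D -> `|y - y'| <= D ->
    `|Num.min x y - Num.min x' y'| <= D.
  by rewrite /Num.min !ler_norml; case: (ltP x y); case: (ltP x' y'); lra.
apply: (@klipschitzW _ _ _ k) => [|[x y] _ /=].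
  exact: (@globally_properfilter _ _ (0, 0)).
have := normr_ge0 a.1.1; have := normr_ge0 a.1.2; have := normr_ge0 b.1.1.
have := normr_ge0 b.1.2; have := normr_ge0 c.1.1; have := normr_ge0 c.1.2.
move=> ? ? ? ? ? ?.
apply: (minL); last by apply: (aff c); rewrite /k; lra.
by apply: minL; [apply: (aff a)|apply: (aff b)]; rewrite /k; lra.
Qed.

(** A neighbourhood of [p] of radius at most half the length of (0, a)
    meets at most one of the two ends, so that in it the interval is a
    half-line.  The sign [sg] points towards the end nearest to [p]. *)
Lemma itv_local_half_line (a p r : R) : 0 < a -> r <= a / 2 ->
  exists (sg d : R), sg * sg = 1 /\
    forall t, `|p - t| < r -> (0 < t < a <-> sg * (t - p) < d).
Proof.
move=> a0 ra; have [pa|pa] := ltP p (a / 2).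
  exists (-1), p; split=> [|t]; first by rewrite mulrNN mulr1.
  by rewrite ltr_norml; split=> *; lra.
exists 1, (a - p); split=> [|t]; first by rewrite mulr1.
by rewrite ltr_norml; split=> *; lra.
Qed.

(** The last vector of this frame has all three components of the signs
    prescribed by [sg], so that it points out of every face of the corresponding
    octant at once.  The frame comes from the orthogonal matrix with entries
    (2, 1, -2), (2, -2, 1), (1, 2, 2) over 3, which avoids square roots. *)
Definition octant_frame (sg : R3 R) (j : 'I_3) : R3 R :=
  [:: ((sg.1.1 * (2 / 3), sg.1.2 * (1 / 3)), sg.2 * (- 2 / 3));
      ((sg.1.1 * (2 / 3), sg.1.2 * (- 2 / 3)), sg.2 * (1 / 3));
      ((sg.1.1 * (1 / 3), sg.1.2 * (2 / 3)), sg.2 * (2 / 3))]`_j.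

Lemma octant_frame_orthonormal (sg : R3 R) i j :
  sg.1.1 * sg.1.1 = 1 -> sg.1.2 * sg.1.2 = 1 -> sg.2 * sg.2 = 1 ->
  dot3 (octant_frame sg i) (octant_frame sg j) = (i == j)%:R.
Proof.
move=> s0 s1 s2; rewrite dot3E; move: i j.
by apply: forall_ord3; apply: forall_ord3; rewrite /octant_frame/=; lra.
Qed.

(** Near any point the box coincides with an octant
    { y | sg_i (y_i - p_i) < d_i for i = 0, 1, 2 }.  In the coordinates c_k of
    the octant frame, each of the three inequalities has a positive coefficient
    on c_2, hence bounds c_2 by an affine function of c_0 and c_1; the octant is
    the region below the minimum of these three functions. *)
Lemma lipschitz_boundary_obox (s : R3 R) : (forall i, 0 < coord3 s i) ->
  lipschitz_boundary (obox 0 s).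
Proof.
move=> s_gt0 p _.
have [s0 s1 s2] := And3 (s_gt0 0) (s_gt0 1) (s_gt0 2).
rewrite /coord3/= in s0 s1 s2.
pose r := Num.min (Num.min (s.1.1 / 2) (s.1.2 / 2)) (s.2 / 2).
have r0 : 0 < r by rewrite !lt_min !divr_gt0.
have [rs0 rs1 rs2] : [/\ r <= s.1.1 / 2, r <= s.1.2 / 2 & r <= s.2 / 2].
  by split; rewrite !ge_min lexx ?orbT.
have [g0 [d0 [gg0 loc0]]] := itv_local_half_line p.1.1 s0 rs0.
have [g1 [d1 [gg1 loc1]]] := itv_local_half_line p.1.2 s1 rs1.
have [g2 [d2 [gg2 loc2]]] := itv_local_half_line p.2 s2 rs2.
exists (octant_frame ((g0, g1), g2)).
(* Solving for c_2 the inequalities 2 c_0 + 2 c_1 + c_2 < 3 d_0,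
   c_0 - 2 c_1 + 2 c_2 < 3 d_1 and - 2 c_0 + c_1 + 2 c_2 < 3 d_2. *)
have := lipschitz_min_affine2 ((-2, -2), 3 * d0) ((- (1 / 2), 1), 3 / 2 * d1)
  ((1, - (1 / 2)), 3 / 2 * d2).
set g := (X in lipschitz X) => lipg.
exists g, r; split=> //.
  by move=> i j; exact: octant_frame_orthonormal.
move=> y [[b0 b1] b2].
have {}loc0 := loc0 _ b0; have {}loc1 := loc1 _ b1; have {}loc2 := loc2 _ b2.
rewrite !dot3E /octant_frame/= /g/= !lt_min.
split=> [[[]]|/andP[/andP[c0 c1] c2]].
  rewrite /= !in_itv => /loc0 c0 /loc1 c1 /loc2 c2.
  by apply/andP; split; [apply/andP; split|]; lra.
(split; first split); rewrite /= in_itv/=;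
  [apply/loc0|apply/loc1|apply/loc2]; lra.
Qed.

Lemma lipschitz_domain_obox (s : R3 R) : (forall i, 0 < coord3 s i) ->
  lipschitz_domain (obox 0 s).
Proof.
move=> s_gt0; have [s0 s1 s2] := And3 (s_gt0 0) (s_gt0 1) (s_gt0 2).
rewrite /coord3/= in s0 s1 s2.
have s_neq0 : obox 0 s !=set0.
  exists ((s.1.1 / 2, s.1.2 / 2), s.2 / 2).
  by (split; first split); rewrite /= in_itv/=; lra.
split=> //; [exact: open_obox|exact: connected_obox|exact: bounded_set_obox|].
exact: lipschitz_boundary_obox.
Qed.

End lipschitz_box.

(** * Boxes are homeomorphic to the unit ball *)

Section homeomorphisms.
Context {R : realType}.

Lemma homeomorphic_through (S T U : topologicalType) (A : set S) (B : set T)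
    (f : S -> U) (f' : U -> S) (h : T -> U) (h' : U -> T) :
  {within A, continuous f} -> continuous f' -> set_fun setT A f' ->
  (forall x, A x -> f' (f x) = x) -> (forall y, f (f' y) = y) ->
  {within B, continuous h} -> continuous h' -> set_fun setT B h' ->
  (forall x, B x -> h' (h x) = x) -> (forall y, h (h' y) = y) ->
  homeomorphic A B.
Proof.
move=> cf cf' f'A f'f ff' ch ch' h'B h'h hh'.
exists (h' \o f), (f' \o h); split.
- exact: (continuousT_comp (S := subspace A) cf ch').
- exact: (continuousT_comp (S := subspace B) ch cf').
- by split=> x _; [exact: h'B|exact: f'A].
- by move=> x Ax; rewrite /= hh' f'f.
- by move=> x Bx; rewrite /= ff' h'h.
Qed.

(** The maps x |-> stretch (|x|^2) x and y |-> shrink (|y|^2) y are inverse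
    homeomorphisms between the open unit ball and the whole space.  The same
    formula in dimension 1 and in each coordinate opens a box onto the space;
    both cases rest on the next two identities between radial factors. *)
Definition stretch (n : R) : R := (Num.sqrt (1 - n))^-1.

Definition shrink (n : R) : R := (Num.sqrt (1 + n))^-1.

Lemma shrink_stretch n : n < 1 -> shrink (stretch n ^+ 2 * n) * stretch n = 1.
Proof.
move=> n1; rewrite /shrink /stretch.
have w0 : 0 < Num.sqrt (1 - n) by rewrite sqrtr_gt0 subr_gt0.
set w := Num.sqrt (1 - n) in w0 *.
have -> : 1 + w^-1 ^+ 2 * n = w^-1 ^+ 2.
  have -> : n = 1 - w ^+ 2 by rewrite sqr_sqrtr ?subr_ge0 ?ltW//; ring.
  by field; rewrite gt_eqF.
by rewrite sqrtr_sqr ger0_norm ?invr_ge0 ?ltW// invrK mulfV ?gt_eqF.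
Qed.

Lemma stretch_shrink n : 0 <= n -> stretch (shrink n ^+ 2 * n) * shrink n = 1.
Proof.
move=> n0; rewrite /shrink /stretch.
have w0 : 0 < Num.sqrt (1 + n) by rewrite sqrtr_gt0 ltr_pwDl.
set w := Num.sqrt (1 + n) in w0 *.
have -> : 1 - w^-1 ^+ 2 * n = w^-1 ^+ 2.
  have -> : n = w ^+ 2 - 1 by rewrite sqr_sqrtr ?addr_ge0//; ring.
  by field; rewrite gt_eqF.
by rewrite sqrtr_sqr ger0_norm ?invr_ge0 ?ltW// invrK mulfV ?gt_eqF.
Qed.

Lemma shrink_lt1 n : 0 <= n -> shrink n ^+ 2 * n < 1.
Proof.
move=> n0; rewrite /shrink exprVn sqr_sqrtr ?addr_ge0//.
by rewrite ltr_pdivrMl ?ltr_pwDl// mulr1 ltrDr.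
Qed.

Lemma continuous_stretch (T : topologicalType) (n : T -> R) (x : T) :
  n x < 1 -> {for x, continuous n} -> {for x, continuous (stretch \o n)}.
Proof.
move=> n1 cn; apply: cvgV; first by rewrite gt_eqF// sqrtr_gt0 subr_gt0.
apply: (@continuous_comp _ _ _ (fun y => 1 - n y) Num.sqrt).
  by apply: cvgB => //; exact: cvg_cst.
exact: sqrt_continuous.
Qed.

Lemma continuous_shrink (T : topologicalType) (n : T -> R) (x : T) :
  0 <= n x -> {for x, continuous n} -> {for x, continuous (shrink \o n)}.
Proof.
move=> n0 cn; apply: cvgV; first by rewrite gt_eqF// sqrtr_gt0 ltr_pwDl.
apply: (@continuous_comp _ _ _ (fun y => 1 + n y) Num.sqrt).
  by apply: cvgD => //; exact: cvg_cst.
exact: sqrt_continuous.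
Qed.

End homeomorphisms.

Section ball_and_box.
Context {R : realType}.

(** The affine map of (0, a) onto (-1, 1), followed by the radial map. *)
Definition itv_stretch (a u : R) : R :=
  stretch ((2 / a * u - 1) ^+ 2) * (2 / a * u - 1).

Definition itv_shrink (a y : R) : R := a * ((1 + shrink (y ^+ 2) * y) / 2).

Lemma itv_norm_lt1 (a u : R) : 0 < u < a -> (2 / a * u - 1) ^+ 2 < 1.
Proof.
move=> /andP[u0 ua]; have a0 : 0 < a by exact: lt_trans ua.
have : u / a < 1 by rewrite ltr_pdivrMr// mul1r.
have : 0 < u / a by rewrite divr_gt0.
by rewrite -mulrA [_^-1 * u]mulrC; nra.
Qed.

Lemma itv_stretchK (a u : R) : 0 < u < a -> itv_shrink a (itv_stretch a u) = u.
Proof.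
move=> u0a; have a0 : 0 < a by case/andP: u0a; exact: lt_trans.
have := shrink_stretch (itv_norm_lt1 u0a).
rewrite /itv_shrink /itv_stretch exprMn; set t := 2 / a * u - 1.
by move=> tE; rewrite [shrink _ * _]mulrA tE /t; field; rewrite gt_eqF.
Qed.

Lemma itv_shrinkK (a y : R) : 0 < a -> itv_stretch a (itv_shrink a y) = y.
Proof.
move=> a0; rewrite /itv_stretch /itv_shrink.
have -> : 2 / a * (a * ((1 + shrink (y ^+ 2) * y) / 2)) - 1 =
    shrink (y ^+ 2) * y.
  by field; rewrite gt_eqF.
by rewrite exprMn mulrA stretch_shrink ?sqr_ge0// mul1r.
Qed.

Lemma itv_shrink_itv (a y : R) : 0 < a -> 0 < itv_shrink a y < a.
Proof.
move=> a0; have := shrink_lt1 (sqr_ge0 y); rewrite -exprMn.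
rewrite /itv_shrink; set t := shrink _ * y => t1.
have : -1 < t < 1 by apply/andP; nra.
move=> /andP[tm tp]; apply/andP; split; first by rewrite mulr_gt0//; lra.
by rewrite gtr_pMr//; lra.
Qed.

Lemma continuous_itv_stretch (a u : R) : 0 < u < a ->
  {for u, continuous (itv_stretch a)}.
Proof.
move=> u0a.
have ct : {for u, continuous (fun v => 2 / a * v - 1)}.
  apply: cvgB; last exact: cvg_cst.
  by apply: cvgM; [exact: cvg_cst|exact: cvg_id].
apply: cvgM => //.
apply: (@continuous_stretch _ _ (fun v => (2 / a * v - 1) ^+ 2)).
  exact: itv_norm_lt1.
exact: cvgM.
Qed.

Lemma continuous_itv_shrink (a : R) : continuous (itv_shrink a).
Proof.
move=> y; apply: cvgM; first exact: cvg_cst.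
apply: cvgM; last exact: cvg_cst.
apply: cvgD; first exact: cvg_cst.
apply: cvgM; last exact: cvg_id.
apply: (@continuous_shrink _ _ (fun v : R => v ^+ 2) y (sqr_ge0 y)).
by apply: cvgM; exact: cvg_id.
Qed.

Definition coordwise (f : R3 (R -> R)) (x : R3 R) : R3 R :=
  ((f.1.1 x.1.1, f.1.2 x.1.2), f.2 x.2).

Lemma continuous_coordwise (f : R3 (R -> R)) (x : R3 R) :
  {for x.1.1, continuous f.1.1} -> {for x.1.2, continuous f.1.2} ->
  {for x.2, continuous f.2} -> {for x, continuous (coordwise f)}.
Proof.
move=> c0 c1 c2; apply: continuous_at_pair; first apply: continuous_at_pair.
- exact: (@continuous_comp _ _ _ (fun y : R3 R => coord3 y 0) f.1.1 x
    (@coord_continuous3 R 0 x) c0).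
- exact: (@continuous_comp _ _ _ (fun y : R3 R => coord3 y 1) f.1.2 x
    (@coord_continuous3 R 1 x) c1).
- exact: (@continuous_comp _ _ _ (fun y : R3 R => coord3 y 2) f.2 x
    (@coord_continuous3 R 2 x) c2).
Qed.

Lemma homeomorphic_obox_ball (s : R3 R) : (forall i, 0 < coord3 s i) ->
  homeomorphic (obox 0 s) (@unit_ball3 R).
Proof.
move=> s_gt0; have [s0 s1 s2] := And3 (s_gt0 0) (s_gt0 1) (s_gt0 2).
rewrite /coord3/= in s0 s1 s2.
apply: (@homeomorphic_through _ _ (R3 R) _ _
  (coordwise ((itv_stretch s.1.1, itv_stretch s.1.2), itv_stretch s.2))
  (coordwise ((itv_shrink s.1.1, itv_shrink s.1.2), itv_shrink s.2))
  (fun x => stretch (dot3 x x) *: x) (fun x => shrink (dot3 x x) *: x)).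
- rewrite continuous_open_subspace; last exact: open_obox.
  move=> x /set_mem[[]]; rewrite /= !in_itv/= => x0 x1 x2.
  by apply: continuous_coordwise; exact: continuous_itv_stretch.
- by move=> x; apply: continuous_coordwise; exact: continuous_itv_shrink.
- by move=> x _; (split; first split); rewrite /= in_itv/=; exact: itv_shrink_itv.
- move=> [[x0 x1] x2] [[]]; rewrite /= !in_itv/= => h0 h1 h2.
  by rewrite /coordwise/= !itv_stretchK.
- by move=> [[y0 y1] y2]; rewrite /coordwise/= !itv_shrinkK.
- rewrite continuous_open_subspace.
    move=> x /set_mem x1; apply: cvgZ; last exact: cvg_id.
    apply: (@continuous_stretch _ _ (fun x => dot3 x x)) => //.
    exact: continuous_dot3.
  rewrite /unit_ball3 (_ : [set _ | _] = (fun x => dot3 x x) @^-1` `]-oo, 1[).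
    by apply: open_comp; [move=> x _; exact: continuous_dot3|exact: interval_open].
  by apply/seteqP; split=> x /=; rewrite in_itv.
- move=> x; apply: cvgZ; last exact: cvg_id.
  apply: (@continuous_shrink _ _ (fun x => dot3 x x)); first exact: dot3_ge0.
  exact: continuous_dot3.
- by move=> x _; rewrite /unit_ball3/= dot3Z shrink_lt1// dot3_ge0.
- by move=> x x1; rewrite scalerA dot3Z shrink_stretch// scale1r.
- by move=> y; rewrite scalerA dot3Z stretch_shrink ?scale1r// dot3_ge0.
Qed.

End ball_and_box.

(** * A flat box with small eigenvalues *)

Lemma sin_natpi (R : realType) (n : nat) : sin (n%:R * pi : R) = 0.
Proof.
elim: n => [|n IHn]; first by rewrite mul0r sin0.
by rewrite -natr1 mulrDl mul1r sinDpi IHn oppr0.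
Qed.

(** The eigenvalues of these modes depend only on the two horizontal sides,
    which leaves the height free to fix the volume. *)
Lemma eigenvalues_upto_box (R : realType) (s : R3 R) (n : nat) (t : R) :
  (forall i, 0 < coord3 s i) ->
  (forall k : 'I_n, (k.+1%:R * pi / s.1.1) ^+ 2 + (pi / s.1.2) ^+ 2 <= t) ->
  eigenvalues_upto (obox 0 s) n t.
Proof.
move=> s_gt0 le_t; have [s0 s1] := (s_gt0 0, s_gt0 1).
rewrite /coord3/= in s0 s1.
pose p (k : 'I_n) := k.+1%:R * pi / s.1.1; pose q := pi / s.1.2.
have p_gt0 k : 0 < p k by rewrite !mulr_gt0 ?pi_gt0 ?invr_gt0.
have q_gt0 : 0 < q by rewrite divr_gt0 ?pi_gt0.
have eigE k : maxwell_eigenfield (obox 0 s) (p k ^+ 2 + q ^+ 2) (mode (p k) q).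
  apply: maxwell_eigenfield_mode => //.
    by rewrite divfK ?gt_eqF// sin_natpi.
  by rewrite divfK ?gt_eqF// sinpi.
exists (fun k => p k ^+ 2 + q ^+ 2), (fun k => mode (p k) q); split=> //.
apply: eigenfields_independent eigE; first exact: measurable_obox.
move=> j k /addIr/eqP; rewrite eqrXn2 ?ltW// => /eqP.
have pis_neq0 : pi / s.1.1 != 0 by rewrite gt_eqF// divr_gt0 ?pi_gt0.
rewrite /p -!mulrA => /(mulIf pis_neq0)/eqP; rewrite eqr_nat eqSS => /eqP.
exact: val_inj.
Qed.

Theorem corollary1p2 (R : realType) (N : nat) (eps : R) (eps_gt0 : 0 < eps) :
  exists Omega : set (R3 R),
    [/\ lipschitz_domain Omega,
        leb3 Omega = 1%E,
        (forall j : nat, (1 <= j <= N)%N ->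
           (maxwell_eigenvalue Omega j <= eps%:E)%E)
      & homeomorphic Omega (@unit_ball3 R)].
Proof.
(* The factor 1 + 1 / eps is chosen because eps (1 + 1 / eps)^2 >= 1, which
   bounds the eigenvalues (k^2 + 1) / ((N + 1) (1 + 1 / eps))^2, for k <= N,
   by eps. *)
pose L : R := pi * (N.+1%:R * (1 + eps^-1)).
have pi0 := pi_gt0 R.
have e1 : 0 < 1 + eps^-1 by rewrite addr_gt0 ?invr_gt0.
have L_gt0 : 0 < L by rewrite !mulr_gt0.
pose s : R3 R := ((L, L), (L ^+ 2)^-1).
have s_gt0 : forall i, 0 < coord3 s i.
  by apply: forall_ord3; rewrite /coord3//= invr_gt0 exprn_gt0.
exists (obox 0 s); split.
- exact: lipschitz_domain_obox.
- rewrite leb3_obox /= ?invr_gt0 ?exprn_gt0// !subr0 -expr2 mulfV//.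
  by rewrite expf_eq0 gt_eqF.
- move=> j /andP[_ jN]; apply: ereal_inf_lbound; exists eps => //.
  apply: eigenvalues_upto_box => // k; rewrite /s/=.
  have kN : k.+1%:R <= N%:R :> R by rewrite ler_nat (leq_trans _ jN).
  have -> : (k.+1%:R * pi / L) ^+ 2 + (pi / L) ^+ 2 =
      (k.+1%:R ^+ 2 + 1) / (N.+1%:R ^+ 2 * (1 + eps^-1) ^+ 2).
    rewrite -mulrA /L -[in RHS]exprMn; set X := _ * (1 + _).
    by rewrite invfM mulVKf ?gt_eqF// exprMn exprVn mulrDl mul1r.
  rewrite ler_pdivrMr ?mulr_gt0 ?exprn_gt0//.
  apply: (@le_trans _ _ (N.+1%:R ^+ 2)).
    rewrite -[N.+1%:R]natr1; have : 0 <= k.+1%:R :> R by [].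
    by nra.
  rewrite mulrCA ler_peMr ?exprn_ge0//.
  have -> : eps * (1 + eps^-1) ^+ 2 = eps + 2 + eps^-1.
    by field; rewrite gt_eqF.
  have : 0 < eps^-1 by rewrite invr_gt0.
  by lra.
- exact: homeomorphic_obox_ball.
Qed.
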